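(* Every infinite-dimensional Banach space $X$ has a closed infinite-dimensional subspace $W$ which either has an unconditional basis or is hereditarily indecomposable.
   Context: Spaces and subspaces are infinite-dimensional and subspaces are closed. A (Schauder) basis of a Banach space is a sequence $(x_n)_{n=1}^\infty$ such that every vector can be written uniquely as a norm-convergent sum $\sum_{n=1}^\infty a_nx_n$ with scalars $a_n$; it is unconditional if $\sum a_nx_n$ converges unconditionally whenever it converges. A Banach space is decomposable if it can be written as a topological direct sum $Y\oplus Z$ of two infinite-dimensional closed subspaces (with continuous projections onto $Y$ and $Z$); it is hereditarily indecomposable if no infinite-dimensional closed subspace of it is decomposable. *)

(* Defs.v *)
From HB Require Import structures.
From mathcomp Require Import all_boot all_order all_algebra.
From mathcomp Require Import all_classical all_reals all_analysis.
From mathcomp Require Import complex.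

Set Implicit Arguments.
Unset Strict Implicit.
Unset Printing Implicit Defensive.

Import Order.TTheory GRing.Theory Num.Theory.
Import numFieldNormedType.Exports.

Local Open Scope classical_set_scope.
Local Open Scope ring_scope.

(* Subspaces are subsets of an ambient normed space X over K, carrying the
   norm, hence the convergence, of X. *)

Definition finite_dimensional (K : numFieldType) (X : normedModType K)
    (W : set X) : Prop :=
  exists (n : nat) (v : 'I_n -> X),
    (forall i, W (v i)) /\
    (forall x, W x -> exists c : 'I_n -> K, x = \sum_(i < n) c i *: v i).

Definition closed_inf_subspace (K : numFieldType) (X : normedModType K)
    (W : set X) : Prop :=
  [/\ submod_closed (mem W), closed W & ~ finite_dimensional W].

Definition schauder_basis (K : numFieldType) (X : normedModType K)
    (W : set X) (e : nat -> X) : Prop :=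
  (forall n, W (e n)) /\
  (forall x, W x ->
    exists! a : nat -> K, series (fun n => a n *: e n) @ \oo --> x).

(* A series converges unconditionally when all its rearrangements converge. *)
Definition unconditionally_convergent (K : numFieldType) (X : normedModType K)
    (u : nat -> X) : Prop :=
  forall s : nat -> nat, bijective s -> cvgn (series (fun n => u (s n))).

Definition unconditional_basis (K : numFieldType) (X : normedModType K)
    (W : set X) (e : nat -> X) : Prop :=
  schauder_basis W e /\
  (forall a : nat -> K, cvgn (series (fun n => a n *: e n)) ->
    unconditionally_convergent (fun n => a n *: e n)).

(* Only the values of p and q on W matter: there they are forced to be the
   (linear) projections onto Y and Z. *)
Definition topological_direct_sum (K : numFieldType) (X : normedModType K)
    (W Y Z : set X) : Prop :=
  [/\ W = [set y + z | y in Y & z in Z],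
      Y `&` Z = [set 0] &
      exists p q : X -> X,
        [/\ forall y z, Y y -> Z z -> p (y + z) = y /\ q (y + z) = z,
            {within W, continuous p} &
            {within W, continuous q}]].

Definition decomposable (K : numFieldType) (X : normedModType K)
    (W : set X) : Prop :=
  exists Y Z : set X,
    [/\ closed_inf_subspace Y, closed_inf_subspace Z &
        topological_direct_sum W Y Z].

Definition hereditarily_indecomposable (K : numFieldType)
    (X : normedModType K) (W : set X) : Prop :=
  forall V : set X, closed_inf_subspace V -> V `<=` W -> ~ decomposable V.

(* Main.v *)
(* Maurey's form of Gowers' argument.  For [eps > 0] put
   [gap eps u v = |u - v| - eps |u + v|].  A subspace [Z] accepts [(u, v)] below
   [q] if any two subspaces [U, V] of [Z] contain [u', v'] with
   [gap eps (u + u') (v + v') < q], and rejects it if no subspace of [Z] accepts.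
   If [W] accepts [(0, 0)] below [0] for every [eps], no two subspaces of [W] can
   be separated by a bounded projection, so [W] is hereditarily indecomposable,
   and such a [W] is obtained by diagonalization as soon as, for each [eps],
   accepting subspaces are dense.  Otherwise some [Z], chosen so that (up to an
   arbitrarily small change of [q]) every pair is accepted or rejected, rejects
   [(0, 0)].  A rejected pair stays rejected when multiples of a suitable vector
   are added to either side, so one can choose vectors [w_i] such that all
   partitions [(u, v)] of all combinations of the [w_i] with bounded coefficients
   are rejected.  Hence [eps |u + v| <= |u - v| + 1] for these, and by
   homogeneity [(w_i)] is an unconditional basis of its closed span. *)

Require Import Defs.
From mathcomp Require Import all_boot all_order all_algebra.
From mathcomp Require Import all_classical all_reals all_analysis.
From mathcomp Require Import complex lra.
Import Order.TTheory GRing.Theory Num.Theory.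
Import numFieldNormedType.Exports.
Local Open Scope classical_set_scope.
Local Open Scope ring_scope.

(* What the argument needs of the scalars, so as to treat [R] and [R[i]] at once;
   norms, which are scalars, are read in [R] through [of_real]. *)
Record scalar_field (R : realType) := ScalarField {
  scalars :> numFieldType;
  of_real : {rmorphism R -> scalars};
  of_real_le : {mono of_real : r s / r <= s};
  nonneg_real : forall k : scalars, 0 <= k -> exists r, of_real r = k;
  scalar_complete : forall a : nat -> scalars,
    (forall e : R, 0 < e -> exists n, forall m, (n <= m)%N ->
       `|a m - a n| < of_real e) ->
    exists l, forall e : R, 0 < e -> exists n, forall m, (n <= m)%N ->
       `|l - a m| < of_real e;
  disc_net : forall M e, 0 < e -> exists s : seq scalars,
    forall a, `|a| <= of_real M -> exists2 b, b \in s & `|a - b| < of_real e }.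

Lemma exists_null_sequence (R : realType) : exists2 r : nat -> R,
  (forall n, 0 < r n) &
  forall e, 0 < e -> exists n, forall m, (n <= m)%N -> r m < e.
Proof.
exists (fun n => n.+1%:R^-1) => [n|e e0]; first by rewrite invr_gt0 ltr0Sn.
have [n] := ltr_add_invr e0; rewrite add0r => hn; exists n => m nm.
by apply: le_lt_trans hn; rewrite lef_pV2 ?posrE ?ltr0Sn// ler_nat.
Qed.

(** * Real-valued norms, limits and Cauchy sequences *)

Section RealNorm.
Set Implicit Arguments.
Unset Strict Implicit.
Variables (R : realType) (K : scalar_field R).
Local Notation inj := (of_real _ K).

(** Norms with values in [R] give access to a total order and to linear arithmetic, which a general
    [K] need not have. *)
Definition rnorm (V : normedZmodType K) (x : V) : R :=
  sval (cid (nonneg_real _ K _ (normr_ge0 x))).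

Lemma rnormE (V : normedZmodType K) (x : V) : inj (rnorm x) = `|x|.
Proof. by rewrite /rnorm; case: cid. Qed.

Lemma of_real_lt : {mono inj : r s / r < s}.
Proof. by move=> r s; rewrite !lt_neqAle of_real_le (inj_eq (fmorph_inj _)). Qed.

Lemma nonneg_rnorm (k : K) : 0 <= k -> inj (rnorm (k : K)) = k.
Proof. by move=> k0; rewrite rnormE ger0_norm. Qed.

Section Zmod.
Variable V : normedZmodType K.
Implicit Types x y : V.

Lemma norm_ltE x e : (`|x| < inj e) = (rnorm x < e).
Proof. by rewrite -rnormE of_real_lt. Qed.

Lemma norm_leE x e : (`|x| <= inj e) = (rnorm x <= e).
Proof. by rewrite -rnormE of_real_le. Qed.

Lemma rnorm_ge0 x : 0 <= rnorm x.
Proof. by rewrite -(of_real_le _ K) rmorph0 rnormE. Qed.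

Lemma rnorm_eq0 x : (rnorm x == 0) = (x == 0).
Proof. by rewrite -(inj_eq (fmorph_inj inj)) rmorph0 rnormE normr_eq0. Qed.

Lemma rnorm0 : rnorm (0 : V) = 0.
Proof. by apply/eqP; rewrite rnorm_eq0. Qed.

Lemma rnorm_gt0 x : (0 < rnorm x) = (x != 0).
Proof. by rewrite lt_def rnorm_ge0 andbT rnorm_eq0. Qed.

Lemma rnormD x y : rnorm (x + y) <= rnorm x + rnorm y.
Proof. by rewrite -(of_real_le _ K) rmorphD !rnormE ler_normD. Qed.

Lemma rnormN x : rnorm (- x) = rnorm x.
Proof. by apply: (fmorph_inj inj); rewrite !rnormE normrN. Qed.

Lemma rnormBC x y : rnorm (x - y) = rnorm (y - x).
Proof. by rewrite -rnormN opprB. Qed.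

Lemma rnormB x y : rnorm (x - y) <= rnorm x + rnorm y.
Proof. by rewrite -(rnormN y) rnormD. Qed.

Lemma rnorm_triangle x y z : rnorm (x - z) <= rnorm (x - y) + rnorm (y - z).
Proof. by rewrite -[x - z](subrKA y) rnormD. Qed.

Lemma rnorm_small x : (forall e : R, 0 < e -> rnorm x <= e) -> x = 0.
Proof.
move=> h; apply/eqP; rewrite -rnorm_eq0 eq_le rnorm_ge0 andbT.
by apply/ler_addgt0Pr => e e0; rewrite add0r; exact: h.
Qed.

End Zmod.

Lemma rnormZ (V : normedModType K) (a : K) (x : V) :
  rnorm (a *: x) = rnorm a * rnorm x.
Proof. by apply: (fmorph_inj inj); rewrite rmorphM !rnormE normrZ. Qed.

Lemma rnormM (a b : K) : rnorm (a * b) = rnorm a * rnorm b.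
Proof. by apply: (fmorph_inj inj); rewrite rmorphM !rnormE normrM. Qed.

Lemma rnorm1 : rnorm (1 : K) = 1.
Proof. by apply: (fmorph_inj inj); rewrite rmorph1 rnormE normr1. Qed.

Lemma rnorm_of_real (r : R) : 0 <= r -> rnorm (inj r) = r.
Proof.
move=> r0; apply: (fmorph_inj inj); rewrite rnormE ger0_norm //.
by rewrite -(rmorph0 inj) of_real_le.
Qed.

Definition tends (V : normedZmodType K) (u : nat -> V) (l : V) :=
  forall e : R, 0 < e -> exists n, forall m, (n <= m)%N -> rnorm (l - u m) < e.

Definition cauchy_sequence (V : normedZmodType K) (u : nat -> V) :=
  forall e : R, 0 < e -> exists n, forall m, (n <= m)%N -> rnorm (u m - u n) < e.

Lemma tends_cauchy (V : normedZmodType K) (u : nat -> V) l :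
  tends u l -> cauchy_sequence u.
Proof.
move=> ul e e0; have [n hn] := ul (e / 2) (divr_gt0 e0 (ltr0Sn _ _)).
exists n => m nm; have := rnorm_triangle (u m) l (u n).
rewrite (rnormBC (u m) l); have := hn _ nm; have := hn _ (leqnn n); lra.
Qed.

Lemma scalar_cauchy (a : nat -> K) : cauchy_sequence a -> exists l, tends a l.
Proof.
move=> ca; have [e e0|l hl] := scalar_complete _ K a.
  by have [n hn] := ca e e0; exists n => m nm; rewrite norm_ltE hn.
by exists l => e e0; have [n hn] := hl e e0; exists n => m nm; rewrite -norm_ltE hn.
Qed.

Lemma disc_netP M e : 0 < e -> exists s : seq K,
  forall a, rnorm a <= M -> exists2 b, b \in s & rnorm (a - b) < e.
Proof.
move=> e0; have [s hs] := disc_net _ K M e e0; exists s => a.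
by rewrite -norm_leE => /hs [b bs]; rewrite norm_ltE; exists b.
Qed.

Lemma nbhs_rnorm (X : normedModType K) (x : X) (A : set X) :
  nbhs x A <-> exists2 e, 0 < e & forall y, rnorm (x - y) < e -> A y.
Proof.
split=> [/nbhs_normP [e /= e0 h]|[e e0 h]].
  exists (rnorm (e : K)); first by rewrite rnorm_gt0 gt_eqF.
  by move=> y; rewrite -norm_ltE nonneg_rnorm ?ltW //; exact: h.
apply/nbhs_normP; exists (inj e) => /=; first by rewrite -(rmorph0 inj) of_real_lt.
by move=> y /=; rewrite /ball_ /= norm_ltE; exact: h.
Qed.

Lemma tendsP (X : normedModType K) (u : nat -> X) (l : X) :
  u @ \oo --> l <-> tends u l.
Proof.
split=> [ul e e0|ul].
  have /ul [n _ hn] : nbhs l [set y | rnorm (l - y) < e].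
    by apply/nbhs_rnorm; exists e.
  by exists n => m nm; exact: hn.
move=> A /nbhs_rnorm [e e0 h]; have [n hn] := ul e e0.
by exists n => // m /= nm; apply: h; exact: hn.
Qed.

Lemma cauchy_tends (X : completeNormedModType K) (u : nat -> X) :
  cauchy_sequence u -> exists l, tends u l.
Proof.
move=> cu; suff /cvg_ex [l ul] : cvgn u by exists l; apply/tendsP.
apply/cauchy_cvgP; apply: cauchy_exP => e e0.
have e0' : 0 < rnorm (e : K) by rewrite rnorm_gt0 gt_eqF.
have [n hn] := cu _ e0'.
exists (u n); exists n => // m /= nm; rewrite -ball_normE /=.
by rewrite -(nonneg_rnorm (ltW e0)) norm_ltE rnormBC hn.
Qed.

End RealNorm.

(** * Closed subspaces, finite-dimensional enlargements and closed spans *)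

Section Subspaces.
Set Implicit Arguments.
Unset Strict Implicit.
Variables (R : realType) (K : scalar_field R) (X : normedModType K).
Implicit Types (U V W Z : set X) (z : nat -> X) (x y : X).
Local Notation anorm := (@rnorm R K K).
Local Notation rnorm := (@rnorm R K X).

Definition linear_subspace W := W 0 /\ forall (a : K) x y, W x -> W y -> W (a *: x + y).

Definition norm_closed W :=
  forall x, (forall e : R, 0 < e -> exists2 y, W y & rnorm (x - y) < e) -> W x.

Lemma closed_inf_subspaceP W : closed_inf_subspace W <->
  [/\ linear_subspace W, norm_closed W & ~ finite_dimensional W].
Proof.
split=> -[sW cW iW]; split=> //.
- case: sW => W0 WL; split; first by move: W0; rewrite inE.
  by move=> a x y Wx Wy; have := WL a x y; rewrite !inE; exact.
- move=> x xW; apply: cW => B /nbhs_rnorm [e e0 h].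
  by have [y Wy xy] := xW e e0; exists y; split=> //; exact: h.
- case: sW => W0 WL; split; first by rewrite inE.
  by move=> a x y; rewrite !inE; exact: WL.
- move=> x xW; apply: cW => e e0.
  have [|y [Wy xy]] := xW [set y | rnorm (x - y) < e]; last by exists y.
  by apply/nbhs_rnorm; exists e.
Qed.

Section SubspaceClosure.
Variables (W : set X) (sW : linear_subspace W).

Lemma linear_subspaceD x y : W x -> W y -> W (x + y).
Proof. by move=> Wx Wy; rewrite -[x]scale1r; case: sW => _; exact. Qed.

Lemma linear_subspaceZ (a : K) x : W x -> W (a *: x).
Proof. by case: sW => W0 WL Wx; rewrite -[_ *: _]addr0; exact: WL. Qed.

Lemma linear_subspaceN x : W x -> W (- x).
Proof. by move=> Wx; rewrite -scaleN1r; exact: linear_subspaceZ. Qed.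

Lemma linear_subspaceB x y : W x -> W y -> W (x - y).
Proof. by move=> Wx /linear_subspaceN; exact: linear_subspaceD. Qed.

Lemma linear_subspace_sum n (F : 'I_n -> X) : (forall i, W (F i)) -> W (\sum_(i < n) F i).
Proof.
move=> WF; elim/big_ind: _ => // [|x y]; last exact: linear_subspaceD.
by case: sW.
Qed.

End SubspaceClosure.

Lemma linear_subspaceI U V :
  linear_subspace U -> linear_subspace V -> linear_subspace (U `&` V).
Proof.
move=> [U0 UL] [V0 VL]; split=> // a x y [Ux Vx] [Uy Vy].
by split; [exact: UL|exact: VL].
Qed.

Lemma linear_subspace0 : linear_subspace [set 0].
Proof. by split=> // a x y /= -> ->; rewrite scaler0 addr0. Qed.

Lemma norm_closedI U V : norm_closed U -> norm_closed V -> norm_closed (U `&` V).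
Proof.
move=> cU cV x xUV; split; [apply: cU|apply: cV] => e /xUV [y []]; by exists y.
Qed.

Definition add_line x Z : set X := [set y | exists a : K, Z (y - a *: x)].

Lemma sub_add_line x Z : Z `<=` add_line x Z.
Proof. by move=> y Zy; exists 0; rewrite scale0r subr0. Qed.

Lemma mem_add_line x Z : Z 0 -> add_line x Z x.
Proof. by move=> Z0; exists 1; rewrite scale1r subrr. Qed.

Lemma linear_subspace_add_line x Z : linear_subspace Z -> linear_subspace (add_line x Z).
Proof.
move=> sZ; split; first by apply: sub_add_line; case: sZ.
move=> a y t [b Zb] [c Zc]; exists (a * b + c).
rewrite scalerDl opprD addrACA -scalerA -scalerBr.
by apply: linear_subspaceD => //; exact: linear_subspaceZ.
Qed.

(** If [U] is not inside [Z], some [u0] in [U] has a nonzero [x]-coefficient modulo [Z]. Subtracting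
    multiples of [u0] carries [U] into its intersection with [Z], so one more generator is
    enough. *)
Lemma finite_dimensional_add_line U Z x : linear_subspace U -> linear_subspace Z ->
  U `<=` add_line x Z -> finite_dimensional (U `&` Z) -> finite_dimensional U.
Proof.
move=> sU sZ UZ [n [v [vUZ spanv]]].
have [UsubZ|/existsNP[u0 /not_implyP[Uu0 nZu0]]] := pselect (U `<=` Z).
  exists n, v; split=> [i|y Uy]; first by case: (vUZ i).
  by apply: spanv; split=> //; exact: UsubZ.
have [a Za] := UZ _ Uu0.
have a0 : a != 0.
  by apply: contra_notN nZu0 => /eqP a0; move: Za; rewrite a0 scale0r subr0.
exists n.+1, (fun i => if unlift ord0 i is Some j then v j else u0); split.
  by move=> i; case: unlift => // j; case: (vUZ j).
move=> y Uy; have [b Zb] := UZ _ Uy.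
have [|c yc] := spanv (y - (b / a) *: u0).
  split; first by apply: linear_subspaceB => //; exact: linear_subspaceZ.
  have -> : y - (b / a) *: u0 = (y - b *: x) - (b / a) *: (u0 - a *: x).
    by rewrite scalerBr scalerA divfK // opprB addrA subrK.
  by apply: linear_subspaceB => //; exact: linear_subspaceZ.
exists (fun i => if unlift ord0 i is Some j then c j else b / a).
rewrite big_ord_recl unlift_none.
under eq_bigr do rewrite liftK.
by rewrite -yc addrC subrK.
Qed.

(** When [x] is outside [Z], it lies at a distance at least [d > 0] from [Z], so [d] times the
    coefficient of [x] is bounded by the norm of the vector. The coefficients of approximants are
    therefore Cauchy, and their limit is the coefficient sought. *)
Lemma norm_closed_add_line x Z : linear_subspace Z -> norm_closed Z ->
  norm_closed (add_line x Z).
Proof.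
move=> sZ cZ y hy.
have [Zx|nZx] := pselect (Z x).
  apply: sub_add_line; apply: cZ => e /hy [t [a Za] yt]; exists t => //.
  by rewrite -[t](subrK (a *: x)); apply: linear_subspaceD => //; exact: linear_subspaceZ.
have [d d0 hd] : exists2 d : R, 0 < d & forall t, Z t -> d <= rnorm (x - t).
  apply: contrapT => h; apply: nZx; apply: cZ => e e0.
  apply: contrapT => h'; apply: h; exists e => // t Zt.
  by rewrite leNgt; apply/negP => xt; apply: h'; exists t.
have lb (a : K) t : Z t -> anorm a * d <= rnorm (a *: x + t).
  move=> Zt; have [->|a0] := eqVneq a 0; first by rewrite rnorm0 mul0r rnorm_ge0.
  have -> : a *: x + t = a *: (x - (- a^-1 *: t)).
    by rewrite scaleNr opprK scalerDr scalerA divff // scale1r.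
  by rewrite rnormZ ler_wpM2l ?rnorm_ge0 //; apply: hd; exact: linear_subspaceZ.
have [r r0 null] := exists_null_sequence R.
have /choice [s hs] : forall n, exists p : K * X,
    Z p.2 /\ rnorm (y - (p.1 *: x + p.2)) < r n.
  move=> n; have [t [a Za] yt] := hy _ (r0 n).
  by exists (a, t - a *: x); rewrite /= [_ + (t - _)]addrC subrK.
have small (e : R) : 0 < e -> exists n, forall m, (n <= m)%N ->
    rnorm (y - ((s m).1 *: x + (s m).2)) < e.
  move=> /null [n hn]; exists n => m nm.
  exact: lt_trans (proj2 (hs m)) (hn m nm).
have [|a ha] := @scalar_cauchy _ K (fun n => (s n).1).
  move=> e e0; have [n hn] := small (e * d / 2) (divr_gt0 (mulr_gt0 e0 d0) (ltr0Sn _ _)).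
  exists n => m nm; rewrite -(ltr_pM2r d0).
  apply: le_lt_trans (lb _ ((s m).2 - (s n).2) _) _.
    by apply: linear_subspaceB => //; [case: (hs m)|case: (hs n)].
  rewrite scalerBl addrACA -opprD.
  have := rnorm_triangle ((s m).1 *: x + (s m).2) y ((s n).1 *: x + (s n).2).
  rewrite (rnormBC _ y); have := hn _ nm; have := hn _ (leqnn n); lra.
exists a; apply: cZ => e e0.
have ex0 : 0 < e / 2 / (rnorm x + 1).
  by rewrite !divr_gt0 // ltr_wpDl ?rnorm_ge0.
have [n1 h1] := small (e / 2) (divr_gt0 e0 (ltr0Sn _ _)).
have [n2 h2] := ha _ ex0.
pose m := maxn n1 n2; exists (s m).2; first by case: (hs m).
have -> : y - a *: x - (s m).2 =
    (y - ((s m).1 *: x + (s m).2)) - (a - (s m).1) *: x.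
  by rewrite scalerBl opprB opprD !addrA (addrAC _ _ ((s m).1 *: x)) subrK addrAC.
apply: le_lt_trans (rnormB _ _) _; rewrite rnormZ.
have := h1 m (leq_maxl _ _); have := h2 m (leq_maxr _ _).
rewrite ltr_pdivlMr ?ltr_wpDl ?rnorm_ge0 // mulrDr mulr1.
have := rnorm_ge0 (a - (s m).1); lra.
Qed.

(** With [Z] equal to [[set 0]] this is the span of the first [n] vectors; a general [Z] has finite
    codimension in it. One definition serves both uses. *)
Fixpoint add_span z n Z := if n is m.+1 then add_line (z m) (add_span z m Z) else Z.

Lemma linear_subspace_add_span z n Z :
  linear_subspace Z -> linear_subspace (add_span z n Z).
Proof. by move=> sZ; elim: n => //= n IH; exact: linear_subspace_add_line. Qed.

Lemma norm_closed_add_span z n Z : linear_subspace Z -> norm_closed Z ->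
  norm_closed (add_span z n Z).
Proof.
move=> sZ cZ; elim: n => //= n IH; apply: norm_closed_add_line => //.
exact: linear_subspace_add_span.
Qed.

Lemma sub_add_span z n Z : Z `<=` add_span z n Z.
Proof. by elim: n => //= n IH x /IH; exact: sub_add_line. Qed.

Lemma add_span_homo z n m Z : (n <= m)%N -> add_span z n Z `<=` add_span z m Z.
Proof.
elim: m => [|m IH]; first by rewrite leqn0 => /eqP ->.
rewrite leq_eqVlt => /predU1P[-> //|/IH h] x /h; exact: sub_add_line.
Qed.

Lemma mem_add_span z n m Z : linear_subspace Z -> (n < m)%N -> add_span z m Z (z n).
Proof.
move=> sZ nm; apply: (add_span_homo nm) => /=; apply: mem_add_line.
by case: (linear_subspace_add_span z n sZ).
Qed.

Lemma add_spanP z n Z x : add_span z n Z x <->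
  exists c : nat -> K, Z (x - \sum_(i < n) c i *: z i).
Proof.
elim: n x => [|n IH] x /=.
  split=> [Zx|[c]]; last by rewrite big_ord0 subr0.
  by exists (fun=> 0); rewrite big_ord0 subr0.
split=> [[a /IH [c Zc]]|[c Zc]].
  exists (fun i => if i == n then a else c i); rewrite big_ord_recr /= eqxx.
  under eq_bigr => i _ do rewrite (ltn_eqF (ltn_ord i)).
  by rewrite opprD addrA addrAC.
exists (c n); apply/IH; exists c.
by rewrite big_ord_recr /= opprD addrA addrAC in Zc.
Qed.

Lemma finite_dimensional_add_span U z n Z : linear_subspace U -> linear_subspace Z ->
  U `<=` add_span z n Z -> finite_dimensional (U `&` Z) -> finite_dimensional U.
Proof.
move=> + sZ; elim: n U => [|n IH] U sU /= UZ; first by rewrite (setIidl UZ).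
move=> fUZ; apply: (finite_dimensional_add_line sU _ UZ).
  exact: linear_subspace_add_span.
apply: IH; first by apply: linear_subspaceI => //; exact: linear_subspace_add_span.
  by move=> x [].
by rewrite -setIA (setIidr (@sub_add_span z n Z)).
Qed.

Lemma finite_dimensionalS U W : linear_subspace U -> U `<=` W ->
  finite_dimensional W -> finite_dimensional U.
Proof.
move=> sU UW [n [v [Wv spanv]]].
pose z i := if insub i is Some j then v j else 0.
apply: (@finite_dimensional_add_span U z n [set 0]) => //; first exact: linear_subspace0.
  move=> x /UW /spanv [c ->]; apply/add_spanP.
  exists (fun i => if insub i is Some j then c j else 0).
  rewrite -sumrB big1 //= => i _; rewrite /z valK /= subrr //.
exists 0%N, (fun=> 0); split=> [[]//|x [_ ->]]; exists (fun=> 0); by rewrite big_ord0.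
Qed.

Lemma finite_dimensional_span z n : finite_dimensional (add_span z n [set 0]).
Proof.
apply: (@finite_dimensional_add_span _ z n [set 0]) => //.
- exact/linear_subspace_add_span/linear_subspace0.
- exact: linear_subspace0.
- exists 0%N, (fun=> 0); split=> [[]//|x [_ ->]]; exists (fun=> 0); by rewrite big_ord0.
Qed.

(** Linear independence, in the incremental form that an inductive choice of vectors provides. *)
Definition free_sequence z := forall n, ~ add_span z n [set 0] (z n).

Lemma free_sequence_coef z n (c : nat -> K) : free_sequence z ->
  \sum_(i < n) c i *: z i = 0 -> forall i, (i < n)%N -> c i = 0.
Proof.
move=> fz; elim: n => // n IH; rewrite big_ord_recr /= => sum0.
have cn0 : c n = 0.
  apply: contrapT => /eqP cn; apply: (fz n); apply/add_spanP.
  exists (fun i => - (c n)^-1 * c i) => /=.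
  under eq_bigr do rewrite -scalerA.
  rewrite -scaler_sumr scaleNr opprK; apply: (@scalerI _ _ (c n)) => //.
  by rewrite scaler0 scalerDr scalerA divff // scale1r addrC.
move=> i; rewrite ltnS leq_eqVlt => /predU1P[-> //|]; apply: IH.
by rewrite cn0 scale0r addr0 in sum0.
Qed.

(** The coordinates of [z 0, ..., z m] in [m] generators form a matrix with more rows than columns;
    a nonzero row of its left kernel is a linear relation between these vectors. *)
Lemma free_sequence_inf W z : free_sequence z -> (forall n, W (z n)) ->
  ~ finite_dimensional W.
Proof.
move=> fz Wz [m [v [_ spanv]]].
have /choice [c hc] : forall i, exists c : 'I_m -> K, z i = \sum_(j < m) c j *: v j.
  by move=> i; exact: spanv.
pose C : 'M[K]_(m.+1, m) := \matrix_(i, j) c i j.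
have : kermx C != 0.
  rewrite kermx_eq0 -row_leq_rank -ltnNge; apply: leq_ltn_trans (rank_leq_col C) _.
  exact: ltnSn.
case/rowV0Pn => r /sub_kermxP rC /eqP []; apply/rowP => i; rewrite mxE.
pose d i := r 0 (inord i).
have := @free_sequence_coef z m.+1 d fz _ i (ltn_ord i).
rewrite /d inord_val; apply.
transitivity (\sum_(k < m.+1) \sum_(j < m) (r 0 k * C k j) *: v j).
  apply: eq_bigr => k _; rewrite inord_val hc scaler_sumr.
  by apply: eq_bigr => j _; rewrite scalerA mxE.
rewrite exchange_big /= big1 // => j _; rewrite -scaler_suml.
by have /rowP/(_ j) := rC; rewrite !mxE => ->; rewrite scale0r.
Qed.

Definition closed_span z : set X := [set x | forall e : R, 0 < e ->
  exists n, exists2 y, add_span z n [set 0] y & rnorm (x - y) < e].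

Lemma closed_span_min z W : linear_subspace W -> norm_closed W ->
  (forall n, W (z n)) -> closed_span z `<=` W.
Proof.
move=> sW cW Wz x hx; apply: cW => e /hx [n [y /add_spanP[c /=/eqP]]].
rewrite subr_eq0 => /eqP -> xy; exists (\sum_(i < n) c i *: z i) => //.
by apply: linear_subspace_sum => // i; exact: linear_subspaceZ.
Qed.

Lemma mem_closed_span z n : closed_span z (z n).
Proof.
move=> e e0; exists n.+1, (z n); last by rewrite subrr rnorm0.
exact: mem_add_span linear_subspace0 _.
Qed.

Lemma linear_subspace_closed_span z : linear_subspace (closed_span z).
Proof.
split=> [e e0|a x y hx hy e e0].
  by exists 0%N, 0 => //; rewrite subrr rnorm0.
have a0 : 0 < anorm a + 1 by rewrite ltr_wpDl ?rnorm_ge0.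
have [n [x' sx' xx']] := hx _ (divr_gt0 (divr_gt0 e0 (ltr0Sn _ 1)) a0).
have [m [y' sy' yy']] := hy _ (divr_gt0 e0 (ltr0Sn _ 1)).
exists (maxn n m), (a *: x' + y').
  have := linear_subspace_add_span z (maxn n m) linear_subspace0; case=> _; apply.
    by apply: add_span_homo sx'; exact: leq_maxl.
  by apply: add_span_homo sy'; exact: leq_maxr.
rewrite opprD addrACA -scalerBr; apply: le_lt_trans (rnormD _ _) _.
rewrite rnormZ; move: xx'; rewrite ltr_pdivlMr // mulrDr mulr1 mulrC.
have := rnorm_ge0 (x - x'); lra.
Qed.

Lemma norm_closed_closed_span z : norm_closed (closed_span z).
Proof.
move=> x hx e e0; have e2 := divr_gt0 e0 (ltr0Sn R 1).
have [y /(_ _ e2)[n [t st yt]] xy] := hx _ e2.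
by exists n, t => //; have := rnorm_triangle x y t; lra.
Qed.

Lemma closed_inf_span z : free_sequence z -> closed_inf_subspace (closed_span z).
Proof.
move=> fz; apply/closed_inf_subspaceP; split.
- exact: linear_subspace_closed_span.
- exact: norm_closed_closed_span.
- by apply: (free_sequence_inf fz) => n; exact: mem_closed_span.
Qed.

(** Used for diagonal sequences: finitely many vectors outside [Z] cannot prevent a subspace from
    meeting [Z] in infinite dimension. *)
Lemma closed_inf_finite_codim U z n Z : closed_inf_subspace U ->
  closed_inf_subspace Z -> U `<=` add_span z n Z ->
  closed_inf_subspace (U `&` Z).
Proof.
move=> /closed_inf_subspaceP[sU cU iU] /closed_inf_subspaceP[sZ cZ iZ] UZ.
apply/closed_inf_subspaceP; split.
- exact: linear_subspaceI.
- exact: norm_closedI.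
- by move=> fUZ; apply: iU; exact: (finite_dimensional_add_span sU sZ UZ fUZ).
Qed.

Lemma closed_inf_nonzero W : closed_inf_subspace W -> exists2 x, W x & x != 0.
Proof.
move=> /closed_inf_subspaceP[_ _ iW]; apply: contrapT => h; apply: iW.
exists 0%N, (fun=> 0); split=> [[]//|x Wx]; exists (fun=> 0); rewrite big_ord0.
by apply: contrapT => /eqP x0; apply: h; exists x.
Qed.

End Subspaces.

(** * Diagonalization over decreasing sequences of subspaces *)

Section Diagonal.
Set Implicit Arguments.
Unset Strict Implicit.
Variables (R : realType) (K : scalar_field R) (X : normedModType K).
Implicit Types (U V W Y Z : set X) (x y : X).

Lemma extend_free Y (z : nat -> X) n : closed_inf_subspace Y ->
  exists2 x, Y x & ~ add_span z n [set 0] x.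
Proof.
move=> /closed_inf_subspaceP[sY _ iY]; apply: contrapT => h; apply: iY.
apply: (finite_dimensionalS sY _ (finite_dimensional_span z n)) => x Yx.
by apply: contrapT => nx; apply: h; exists x.
Qed.

Lemma eq_add_span (z z' : nat -> X) n Z :
  (forall i, (i < n)%N -> z i = z' i) -> add_span z n Z = add_span z' n Z.
Proof.
elim: n => //= n IH h; rewrite h //; rewrite IH // => i ni.
by apply: h; exact: ltnW.
Qed.

(** Choose decreasing subspaces [S n] of [Y] with [P n (S n)], and vectors [z n] in [S n], each
    outside the span of the earlier ones. All [z m] with [n <= m] lie in [S n], so the closed span
    lies in [S n] plus a finite-dimensional space, and [closed_inf_finite_codim] applies. *)
Lemma diagonal_subspace (P : nat -> set X -> Prop) Y :
  closed_inf_subspace Y ->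
  (forall n U, closed_inf_subspace U -> U `<=` Y ->
    exists V, [/\ closed_inf_subspace V, V `<=` U & P n V]) ->
  exists z : nat -> X, let W := closed_span z in
  [/\ free_sequence z, W `<=` Y &
    forall n, exists V, P n V /\ forall U, closed_inf_subspace U ->
      U `<=` W -> closed_inf_subspace (U `&` V)].
Proof.
move=> cY dense.
pose good U := closed_inf_subspace U /\ U `<=` Y.
(* Choice yields a total function; its value outside the good subspaces is arbitrary. *)
have /choice [f hf] : forall nU : nat * set X, exists V,
    good nU.2 -> [/\ good V, V `<=` nU.2 & P nU.1 V].
  move=> [n U]; have [[cU UY]|nU] := pselect (good U); last by exists U.
  have [V [cV VU PV]] := dense n U cU UY; exists V => _; split=> //.
  by split=> // x /VU /UY.
pose S := fix S n := f (n, if n is m.+1 then S m else Y).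
have SE n : S n.+1 = f (n.+1, S n) by [].
have goodY : good Y by split.
have Sgood n : good (S n) /\ P n (S n).
  elim: n => [|n [gS _]]; first by have [] := hf (0%N, Y) goodY.
  by rewrite SE; have [] := hf (n.+1, S n) gS.
have Sdec n m : (n <= m)%N -> S m `<=` S n.
  elim: m => [|m IH]; first by rewrite leqn0 => /eqP ->.
  rewrite leq_eqVlt => /predU1P[-> //|/IH h] x; rewrite SE => Sx; apply: h.
  by have [_ + _] := hf (m.+1, S m) (proj1 (Sgood m)); exact.
have /choice [g hg] : forall nz : nat * (nat -> X), exists x,
    S nz.1 x /\ ~ add_span nz.2 nz.1 [set 0] x.
  move=> [n z]; have [x Sx nx] := extend_free z n (proj1 (proj1 (Sgood n))).
  by exists x.
(* The choice of [z n] depends on all earlier vectors, so the list of the first [n] is built by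
   recursion; [nth 0] reads it as a sequence of which only the terms below [n] matter. *)
pose L := fix L n : seq X := if n is m.+1 then rcons (L m) (g (m, nth 0 (L m))) else [::].
have szL n : size (L n) = n by elim: n => //= n IH; rewrite size_rcons IH.
pose z n := g (n, nth 0 (L n)).
have zL n i : (i < n)%N -> nth 0 (L n) i = z i.
  elim: n => // n IH; rewrite ltnS leq_eqVlt /= nth_rcons szL.
  by move=> /predU1P[->|ni]; rewrite ?ltnn ?eqxx // ni IH.
have Sz n : S n (z n) by case: (hg (n, nth 0 (L n))).
have fz : free_sequence z.
  move=> n; rewrite -(@eq_add_span (nth 0 (L n))); last exact: zL.
  by case: (hg (n, nth 0 (L n))).
exists z => W; split=> //.
  have [sY clY _] := (closed_inf_subspaceP Y).1 cY.
  apply: closed_span_min => // n; by have [[_ +] _] := Sgood n; apply; exact: Sz.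
move=> n; have [[cS _] PS] := Sgood n; exists (S n); split=> // U cU UW.
 have [sS clS _] := (closed_inf_subspaceP _).1 cS.
apply: (@closed_inf_finite_codim _ _ _ U z n) => // x /UW.
apply: closed_span_min => [||m].
- exact: linear_subspace_add_span.
- exact: norm_closed_add_span.
- have [mn|nm] := ltnP m n; first exact: mem_add_span.
  by apply: sub_add_span; exact: Sdec nm _ (Sz m).
Qed.

End Diagonal.

(** * Accepted and rejected pairs, and hereditary indecomposability *)

Section Acceptance.
Set Implicit Arguments.
Unset Strict Implicit.
Variables (R : realType) (K : scalar_field R) (X : normedModType K).
Implicit Types (U V W Y Z : set X) (x y u v : X) (q e eps : R).
Local Notation anorm := (@rnorm R K K).
Local Notation rnorm := (@rnorm R K X).

Definition gap eps u v := rnorm (u - v) - eps * rnorm (u + v).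

Definition accepts eps Z u v q := forall U V,
  closed_inf_subspace U -> closed_inf_subspace V -> U `<=` Z -> V `<=` Z ->
  exists u' v', [/\ U u', V v' & gap eps (u + u') (v + v') < q].

Definition rejects eps Z u v q :=
  forall Z', closed_inf_subspace Z' -> Z' `<=` Z -> ~ accepts eps Z' u v q.

Lemma gapC eps u v : gap eps u v = gap eps v u.
Proof. by rewrite /gap rnormBC [u + v]addrC. Qed.

Lemma acceptsC eps Z u v q : accepts eps Z u v q -> accepts eps Z v u q.
Proof.
move=> acc U V cU cV UZ VZ; have [v' [u' [Vv Uu h]]] := acc V U cV cU VZ UZ.
by exists u', v'; split=> //; rewrite gapC.
Qed.

Lemma rejectsC eps Z u v q : rejects eps Z u v q -> rejects eps Z v u q.
Proof. by move=> rej Z' cZ' Z'Z /acceptsC; exact: rej. Qed.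

Lemma acceptsS eps Z Z' u v q : Z' `<=` Z ->
  accepts eps Z u v q -> accepts eps Z' u v q.
Proof.
move=> Z'Z acc U V cU cV UZ VZ.
by apply: acc => // x; [move/UZ|move/VZ]; exact: Z'Z.
Qed.

(** Each of the two norms in [gap] moves by at most the total displacement, and the factor [eps] is
    at most 1; hence the constant 2. *)
Lemma gap_lipschitz eps u v u1 v1 : 0 <= eps -> eps <= 1 ->
  gap eps u1 v1 <= gap eps u v + 2 * (rnorm (u - u1) + rnorm (v - v1)).
Proof.
move=> e0 e1; rewrite /gap.
have h1 : rnorm (u1 - v1) <= rnorm (u - v) + (rnorm (u - u1) + rnorm (v - v1)).
  have := rnorm_triangle u1 u v1; have := rnorm_triangle u v v1.
  by rewrite (rnormBC u1 u); lra.
have h2 : rnorm (u + v) <= rnorm (u1 + v1) + (rnorm (u - u1) + rnorm (v - v1)).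
  have -> : u + v = (u1 + v1) + ((u - u1) + (v - v1)).
    by rewrite addrACA [u1 + _]addrC [v1 + _]addrC !subrK.
  by apply: le_trans (rnormD _ _) _; rewrite lerD2l rnormD.
have := ler_wpM2l e0 h2; rewrite mulrDr.
have := ler_wpM2r (addr_ge0 (rnorm_ge0 (u - u1)) (rnorm_ge0 (v - v1))) e1.
lra.
Qed.

Lemma accepts_perturb eps Z u v u1 v1 q q1 : 0 <= eps -> eps <= 1 ->
  q + 2 * (rnorm (u - u1) + rnorm (v - v1)) <= q1 ->
  accepts eps Z u v q -> accepts eps Z u1 v1 q1.
Proof.
move=> e0 e1 qq1 acc U V cU cV UZ VZ.
have [u' [v' [Uu Vv h]]] := acc U V cU cV UZ VZ.
exists u', v'; split=> //; apply: lt_le_trans qq1.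
apply: le_lt_trans (gap_lipschitz (u + u') (v + v') _ _ e0 e1) _.
by rewrite (addrC u1 u') (addrC v1 v') !addrKA ltrD2r.
Qed.

Lemma rejects_perturb eps Z u v u1 v1 q q1 : 0 <= eps -> eps <= 1 ->
  q1 + 2 * (rnorm (u - u1) + rnorm (v - v1)) <= q ->
  rejects eps Z u v q -> rejects eps Z u1 v1 q1.
Proof.
move=> e0 e1 qq1 rej Z' cZ' Z'Z acc; apply: (rej Z' cZ' Z'Z).
by apply: accepts_perturb acc => //; rewrite (rnormBC u1) (rnormBC v1).
Qed.

(** Otherwise [Z] itself would accept, with zero vectors taken in any two subspaces. *)
Lemma rejects_gap eps Z u v q : closed_inf_subspace Z ->
  rejects eps Z u v q -> q <= gap eps u v.
Proof.
move=> cZ rej; rewrite leNgt; apply/negP => lt_q.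
apply: (rej Z cZ (fun _ h => h)) => U V cU cV _ _.
have [[U0 _] _ _] := (closed_inf_subspaceP U).1 cU.
have [[V0 _] _ _] := (closed_inf_subspaceP V).1 cV.
by exists 0, 0; rewrite !addr0.
Qed.

(** Continuity of the projection [p] at 0 bounds it on [V] by [d^-1], whence [rnorm (y + z) <= (2 /
    d + 1) * rnorm (y - z)] for [y] and [z] in the two summands. Acceptance for a large [n]
    contradicts this. *)
Lemma hereditarily_indecomposable_accepts W :
  (forall n, accepts n.+1%:R^-1 W 0 0 0) -> hereditarily_indecomposable W.
Proof.
move=> acc V cV VW [Y [Z [cY cZ [VE _ [p [q [pq cp _]]]]]]].
have [sY _ _] := (closed_inf_subspaceP Y).1 cY.
have [sZ _ _] := (closed_inf_subspaceP Z).1 cZ.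
have [Y0 Z0] : Y 0 /\ Z 0 by split; [case: sY|case: sZ].
have p0 : p 0 = 0 by have [] := pq 0 0 Y0 Z0; rewrite addr0.
have V0 : V 0 by rewrite VE; exists 0 => //; exists 0 => //; rewrite addr0.
have [d d0 hd] : exists2 d : R, 0 < d &
    forall x, V x -> rnorm x < d -> rnorm (p x) < 1.
  have n0 : nbhs (p 0) [set y | rnorm y < 1].
    by rewrite p0; apply/nbhs_rnorm; exists 1 => // y; rewrite sub0r rnormN.
  have /subspace_continuousP/(_ _ V0)/(_ _ n0)/nbhs_rnorm := cp.
  move=> [d d0 h]; exists d => // x Vx xd.
  by apply: h => //; rewrite sub0r rnormN.
have bound y z : Y y -> Z z -> rnorm y <= d^-1 * rnorm (y + z).
  move=> Yy Zz; rewrite leNgt; apply/negP; rewrite mulrC ltr_pdivrMr // => lt_yz.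
  have y0 : 0 < rnorm y.
    rewrite lt_def rnorm_ge0 andbT; apply/eqP => y0.
    by move: lt_yz; rewrite y0 mul0r ltNge rnorm_ge0.
  (* Scaling by [t] makes [y] a unit vector while [t *: (y + z)] has norm below [d]; but then its
     image [t *: y] under [p] should have norm below 1. *)
  pose t := of_real R K (rnorm y)^-1.
  have tE : anorm t = (rnorm y)^-1 by rewrite rnorm_of_real // invr_ge0 ltW.
  have Vt : V (t *: (y + z)).
    rewrite VE scalerDr; exists (t *: y); first exact: linear_subspaceZ.
    by exists (t *: z) => //; exact: linear_subspaceZ.
  have [pE _] := pq (t *: y) (t *: z)
    (linear_subspaceZ sY t Yy) (linear_subspaceZ sZ t Zz).
  have := hd _ Vt; rewrite scalerDr pE -scalerDr !rnormZ tE mulVf ?gt_eqF // ltxx.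
  by rewrite mulrC ltr_pdivrMr // mulrC => /(_ lt_yz).
have cst : 0 < 2 * d^-1 + 1 by rewrite ltr_wpDl // mulr_ge0 // invr_ge0 ltW.
have cst' : 0 < (2 * d^-1 + 1)^-1 by rewrite invr_gt0.
have [n] := ltr_add_invr cst'; rewrite add0r => hn.
have YV : Y `<=` V.
  by move=> y Yy; rewrite VE; exists y => //; exists 0 => //; rewrite addr0.
have ZV : Z `<=` V.
  by move=> z Zz; rewrite VE; exists 0 => //; exists z => //; rewrite add0r.
have [y [z [Yy Zz]]] := acc n Y Z cY cZ (subset_trans YV VW) (subset_trans ZV VW).
rewrite !add0r /gap subr_lt0 => lt_yz.
have ub : rnorm (y + z) <= (2 * d^-1 + 1) * rnorm (y - z).
  have := bound y (- z) Yy (linear_subspaceN sZ Zz).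
  have -> : y + z = y + y - (y - z) by rewrite opprB addrACA subrr addr0.
  have := rnormB (y + y) (y - z); have := rnormD y y; lra.
move: lt_yz; rewrite ltNge => /negP; apply.
rewrite mulrC ler_pdivrMr ?ltr0Sn //.
apply: le_trans ub _; rewrite mulrC ler_wpM2l ?rnorm_ge0 //.
by rewrite ltW // -ltf_pV2 ?posrE.
Qed.

End Acceptance.

(** * Separability, and a subspace that decides all pairs *)

Section Decision.
Set Implicit Arguments.
Unset Strict Implicit.
Variables (R : realType) (K : scalar_field R) (X : normedModType K).
Implicit Types (U V W Y Z : set X) (x y u v : X) (q e eps : R).
Local Notation anorm := (@rnorm R K K).
Local Notation rnorm := (@rnorm R K X).

(** Finite nets of mesh [1 / (n + 1)] in the discs of radius [n] are dense together; the first index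
    selects the disc, the second the point of its net. *)
Lemma dense_scalars : exists d : nat * nat -> K, forall (a : K) e, 0 < e ->
  exists p, anorm (a - d p) < e.
Proof.
have /choice [s hs] : forall n : nat, exists s : seq K,
    forall a : K, anorm a <= n%:R -> exists2 b, b \in s & anorm (a - b) < n.+1%:R^-1.
  by move=> n; apply: disc_netP; rewrite invr_gt0 ltr0Sn.
exists (fun p => nth 0 (s p.1) p.2) => a e e0.
have [k] := ltr_add_invr e0; rewrite add0r => ke.
pose n := maxn k (Num.bound (anorm a)).
have [|b bs ab] := hs n a.
  apply: le_trans (ltW (archi_boundP (rnorm_ge0 a))) _.
  by rewrite ler_nat leq_maxr.
exists (n, index b (s n)); rewrite /= nth_index //; apply: lt_trans ab _.
apply: le_lt_trans ke; rewrite lef_pV2 ?posrE ?ltr0Sn // ler_nat ltnS.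
exact: leq_maxl.
Qed.

(** Finite combinations with coefficients in the countable dense set of scalars are dense, and are
    listed by pickling the finite sequences of indices. *)
Lemma dense_closed_span (z : nat -> X) : exists D : nat -> X,
  (forall n, closed_span z (D n)) /\
  forall x, closed_span z x -> forall e, 0 < e -> exists n, rnorm (x - D n) < e.
Proof.
have [d hd] := dense_scalars.
pose f (s : seq (nat * nat)) := \sum_(i < size s) d (nth (0, 0)%N s i) *: z i.
have fz s : closed_span z (f s).
  apply: linear_subspace_sum => [|i]; first exact: linear_subspace_closed_span.
  exact/(linear_subspaceZ (linear_subspace_closed_span z))/mem_closed_span.
have df n y : add_span z n [set 0] y -> forall e, 0 < e ->
    exists2 s, size s = n & rnorm (y - f s) < e.
  elim: n y => [|n IH] y /=.
    by move=> -> e e0; exists [::] => //; rewrite /f big_ord0 subrr rnorm0.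
  move=> [a ya] e e0; have e2 : 0 < e / 2 by rewrite divr_gt0.
  have [s sn ys] := IH _ ya _ e2.
  have z0 : 0 < rnorm (z n) + 1 by rewrite ltr_wpDl ?rnorm_ge0.
  have [p ap] := hd a _ (divr_gt0 e2 z0).
  exists (rcons s p); first by rewrite size_rcons sn.
  have -> : f (rcons s p) = f s + d p *: z n.
    rewrite /f size_rcons big_ord_recr /= nth_rcons ltnn eqxx sn; congr (_ + _).
    by apply: eq_bigr => i _; rewrite nth_rcons sn ltn_ord.
  have -> : y - (f s + d p *: z n) = (y - a *: z n - f s) + (a - d p) *: z n.
    rewrite scalerBl addrA [_ - f s + _]addrAC subrK opprD addrA; congr (_ - _).
  apply: le_lt_trans (rnormD _ _) _; rewrite rnormZ.
  move: ap; rewrite ltr_pdivlMr // mulrDr mulr1.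
  have := rnorm_ge0 (a - d p); lra.
exists (fun n => if unpickle n is Some s then f s else 0); split.
  move=> n; case: unpickle => [s|]; first exact: fz.
  by case: (linear_subspace_closed_span z).
move=> x hx e e0; have e2 : 0 < e / 2 by rewrite divr_gt0.
have [n [y zy xy]] := hx _ e2; have [s _ ys] := df _ _ zy _ e2.
exists (pickle s); rewrite pickleK.
have := rnorm_triangle x y (f s); lra.
Qed.

(** Countably many triples, made of two points of a dense sequence and a rational level, are settled
    through [diagonal_subspace]. Any other pair is reached by perturbation, which uses up the room
    between [q] and [q']. *)
Lemma deciding_subspace eps (z : nat -> X) : 0 <= eps -> eps <= 1 ->
  free_sequence z -> exists W,
  [/\ closed_inf_subspace W, W `<=` closed_span z &
    forall u v q q', closed_span z u -> closed_span z v -> q < q' ->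
      accepts eps W u v q' \/ rejects eps W u v q].
Proof.
move=> eps0 eps1 fz; have [D [Dz dD]] := dense_closed_span z.
pose P n Z := if unpickle n is Some (i, j, r)
  then accepts eps Z (D i) (D j) (ratr r) \/ rejects eps Z (D i) (D j) (ratr r)
  else True.
have [||w [fw WY hw]] := @diagonal_subspace _ _ _ P (closed_span z).
- exact: closed_inf_span.
- move=> n U cU UY; rewrite /P; case: unpickle => [[[i j] r]|]; last by exists U; split.
  (* Either some subspace of [U] accepts, and is taken, or none does, and [U] rejects. *)
  have [[V [cV VU acc]]|nacc] := pselect (exists V, [/\ closed_inf_subspace V,
      V `<=` U & accepts eps V (D i) (D j) (ratr r)]).
    by exists V; split=> //; left.
  by exists U; split=> //; right=> V cV VU acc; apply: nacc; exists V.
exists (closed_span w); split=> //; first exact: closed_inf_span.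
move=> u v q q' zu zv qq'.
(* Moving both vectors by less than [(q' - q) / 16] changes the level by at most [(q' - q) / 4], the
   distance kept between the rational [r] and both ends. *)
have d0 : 0 < (q' - q) / 16 by rewrite divr_gt0 // subr_gt0.
have [i ui] := dD u zu _ d0; have [j vj] := dD v zv _ d0.
have [|r] := @rat_in_itvoo _ (q + (q' - q) / 4) (q' - (q' - q) / 4); first lra.
rewrite in_itv /= => /andP[qr rq'].
have [V [PV WV]] := hw (pickle (i, j, r)).
move: PV; rewrite /P pickleK => -[acc|rej]; [left|right].
  apply: (@accepts_perturb _ _ _ eps _ (D i) (D j) u v (ratr r)) => //.
    by rewrite (rnormBC _ u) (rnormBC _ v); lra.
  (* [W] need not lie in [V], but subspaces of [W] stay infinite-dimensional when cut down to [V].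
     This transfers acceptance here and rejection below. *)
  move=> U1 U2 cU1 cU2 U1W U2W.
  have [] := acc (U1 `&` V) (U2 `&` V) (WV _ cU1 U1W) (WV _ cU2 U2W).
  - by move=> x [].
  - by move=> x [].
  - by move=> u' [v' [[Uu _] [Vv _] h]]; exists u', v'.
apply: (@rejects_perturb _ _ _ eps _ (D i) (D j) u v (ratr r)) => //.
  by rewrite (rnormBC _ u) (rnormBC _ v); lra.
move=> Z cZ ZW acc; apply: (rej _ (WV _ cZ ZW)); first by move=> x [].
by apply: acceptsS acc => x [].
Qed.

End Decision.

(** * Construction of a sequence with rejected partitions *)

Section Construction.
Set Implicit Arguments.
Unset Strict Implicit.
Variables (R : realType) (K : scalar_field R) (X : normedModType K).
Implicit Types (U V W Y Z : set X) (x y u v : X) (q e : R).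
Local Notation anorm := (@rnorm R K K).
Local Notation rnorm := (@rnorm R K X).

Variables (eps : R) (A Z : set X).
Hypotheses (eps0 : 0 < eps) (eps1 : eps <= 1).
Hypotheses (sA : linear_subspace A) (cZ : closed_inf_subspace Z) (ZA : Z `<=` A).
Hypothesis decides : forall u v q q', A u -> A v -> q < q' ->
  accepts eps Z u v q' \/ rejects eps Z u v q.

(* If every subspace of [Y] contained a [y] with [(u + y, v)] accepted, then
   [Y] itself would accept [(u, v)], since [y] may be absorbed in [U]. *)
Lemma rejects_shift u v q q' Y : A u -> A v -> q' < q -> rejects eps Z u v q ->
  closed_inf_subspace Y -> Y `<=` Z ->
  exists Y', [/\ closed_inf_subspace Y', Y' `<=` Y &
    forall y, Y' y -> rejects eps Z (u + y) v q'].
Proof.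
move=> Au Av q'q rej cY YZ; apply: contrapT => h.
apply: (rej Y cY YZ) => U V cU cV UY VY.
have [y Uy acc] : exists2 y, U y & accepts eps Z (u + y) v q.
  apply: contrapT => h'; apply: h; exists U; split=> // y Uy.
  have Auy : A (u + y) by apply: linear_subspaceD => //; exact/ZA/YZ/UY.
  have [acc|//] := decides Auy Av q'q.
  by case: h'; exists y.
have [u' [v' [Uu' Vv' lt_q]]] :=
  acc U V cU cV (subset_trans UY YZ) (subset_trans VY YZ).
exists (y + u'), v'; split=> //; last by rewrite addrA.
by have [sU _ _] := (closed_inf_subspaceP U).1 cU; exact: linear_subspaceD.
Qed.

(** The pairs are treated one after the other, on both sides, in smaller and smaller subspaces. Each
    falls from [q] to [q'] independently of the others, so the loss does not grow with the length of
    the list. *)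
Lemma rejects_shift_seq (s : seq (X * X)) q q' Y : q' < q ->
  closed_inf_subspace Y -> Y `<=` Z ->
  exists Y', [/\ closed_inf_subspace Y', Y' `<=` Y &
    forall p, p \in s -> A p.1 -> A p.2 -> rejects eps Z p.1 p.2 q ->
      forall y, Y' y -> rejects eps Z (p.1 + y) p.2 q' /\
                        rejects eps Z p.1 (p.2 + y) q'].
Proof.
move=> q'q; elim: s Y => [|[u v] s IH] Y cY YZ; first by exists Y; split.
have [Y1 [cY1 Y1Y h1]] := IH Y cY YZ.
have [h|h] := pselect [/\ A u, A v & rejects eps Z u v q]; last first.
  exists Y1; split=> // p; rewrite inE => /predU1P[->|ps] Ap1 Ap2 rej.
    by case: h; split.
  exact: h1.
have [Au Av rej] := h.
have [Y2 [cY2 Y2Y1 h2]] := rejects_shift Au Av q'q rej cY1 (subset_trans Y1Y YZ).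
have [Y3 [cY3 Y3Y2 h3]] := rejects_shift Av Au q'q (rejectsC rej) cY2
  (subset_trans Y2Y1 (subset_trans Y1Y YZ)).
exists Y3; split=> //.
  exact: subset_trans Y3Y2 (subset_trans Y2Y1 Y1Y).
move=> p; rewrite inE => /predU1P[-> /= _ _ _ y Yy|ps Ap1 Ap2 rejp y Yy].
  by split; [exact/h2/Y3Y2|exact/rejectsC/h3].
by apply: h1 => //; exact/Y2Y1/Y3Y2.
Qed.

(** The points of the nets must lie in [A] because [decides] speaks only of vectors of [A]. *)
Definition totally_bounded_pairs (T : set (X * X)) := forall e, 0 < e ->
  exists s : seq (X * X), (forall p, p \in s -> A p.1 /\ A p.2) /\
    forall t, T t -> exists2 p, p \in s &
      rnorm (t.1 - p.1) + rnorm (t.2 - p.2) < e.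

(** Rejection is stable under small perturbations, so a nonzero [w] in the subspace found for a
    finite net of [T] works for all of [T]; that subspace contains all multiples of [w]. *)
Lemma rejects_shift_set (T : set (X * X)) q q' : q' < q ->
  totally_bounded_pairs T -> (forall t, T t -> rejects eps Z t.1 t.2 q) ->
  exists w, [/\ Z w, w != 0 & forall t (a : K), T t ->
    rejects eps Z (t.1 + a *: w) t.2 q' /\ rejects eps Z t.1 (t.2 + a *: w) q'].
Proof.
move=> q'q tbT rejT; have d0 : 0 < (q - q') / 8 by rewrite divr_gt0 // subr_gt0.
have [s [As hs]] := tbT _ d0.
(* With mesh [(q - q') / 8] a perturbation costs at most [(q - q') / 4]: one quarter is spent to
   reach the net, one on the shift and one to return from the net. *)
have [|Y [cY YZ hY]] := @rejects_shift_seq s (q - (q - q') / 4)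
    (q - (q - q') / 2) Z _ cZ (@subset_refl _ Z); first by lra.
have [w Yw w0] := closed_inf_nonzero cY.
have [sY _ _] := (closed_inf_subspaceP Y).1 cY.
exists w; split=> //; first exact: YZ.
move=> t a Tt; have [p ps tp] := hs t Tt; have [Ap1 Ap2] := As p ps.
have [||rej1 rej2] := hY p ps Ap1 Ap2 _ (a *: w).
- by apply: (rejects_perturb (ltW eps0) eps1 _ (rejT t Tt)); lra.
- exact: linear_subspaceZ.
by split; [apply: (rejects_perturb (ltW eps0) eps1 _ rej1)|
           apply: (rejects_perturb (ltW eps0) eps1 _ rej2)];
  rewrite (addrC _ (a *: w)) (addrC _ (a *: w)) opprD addrACA subrr add0r
    (rnormBC p.1) (rnormBC p.2); lra.
Qed.

(** Only multiples of [w] of norm at most [M] are adjoined, so that total boundedness is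
    preserved. *)
Definition adjoin (M : R) (w : X) (T : set (X * X)) : set (X * X) :=
  [set p | exists t (a : K), [/\ T t, anorm a * rnorm w <= M &
    p = (t.1 + a *: w, t.2) \/ p = (t.1, t.2 + a *: w)]].

(** The admissible coefficients fill a disc of radius [M / rnorm w]. A net of this disc and one of
    [T], each contributing an error below [e / 2], combine into the net required. *)
Lemma totally_bounded_adjoin M w T : A w -> w != 0 ->
  totally_bounded_pairs T -> totally_bounded_pairs (adjoin M w T).
Proof.
move=> Aw w0 tbT e e0; have e2 : 0 < e / 2 by rewrite divr_gt0.
have nw0 : 0 < rnorm w by rewrite rnorm_gt0.
have [s [As hs]] := tbT _ e2.
have [b hb] := @disc_netP R K (M / rnorm w) _ (divr_gt0 e2 nw0).
pose left_shift := [seq (p.1 + c *: w, p.2) | p <- s, c <- b].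
pose right_shift := [seq (p.1, p.2 + c *: w) | p <- s, c <- b].
exists (left_shift ++ right_shift); split.
  move=> p; rewrite mem_cat => /orP[] /allpairsP [[p' c] /= [ps _ ->]] /=;
  have [Ap1 Ap2] := As _ ps; split=> //;
  by apply: linear_subspaceD => //; exact: linear_subspaceZ.
move=> t0 [t [a [Tt aM h]]]; have [p ps tp] := hs t Tt.
have [|c cb ac] := hb a; first by rewrite ler_pdivlMr.
move: ac; rewrite ltr_pdivlMr // => ac.
have shift x y : rnorm (x + a *: w - (y + c *: w)) <=
    rnorm (x - y) + anorm (a - c) * rnorm w.
  by rewrite opprD addrACA -scalerBl -rnormZ; exact: rnormD.
case: h => ->.
  exists (p.1 + c *: w, p.2) => /=.
    rewrite mem_cat; apply/orP; left; apply/allpairsP; by exists (p, c).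
  have := shift t.1 p.1; lra.
exists (p.1, p.2 + c *: w) => /=.
  rewrite mem_cat; apply/orP; right; apply/allpairsP; by exists (p, c).
have := shift t.2 p.2; lra.
Qed.

(** The sets [T n] contain all partitions of combinations of the first [n] vectors with terms of
    norm at most [M], and stay rejected; [rejects_gap] then turns rejection into the inequality. *)
Lemma rejecting_sequence (M : R) : rejects eps Z 0 0 0 ->
  exists w : nat -> X, (forall n, Z (w n) /\ w n != 0) /\
  forall n (a : nat -> K) (I : pred nat),
    (forall i, (i < n)%N -> anorm (a i) * rnorm (w i) <= M) ->
    - 1 <= gap eps (\sum_(i < n | I i) a i *: w i)
                   (\sum_(i < n | ~~ I i) a i *: w i).
Proof.
(* The levels start at 0, where rejection is assumed, decrease strictly to leave room for each
   shift, and stay above -1. *)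
move=> rej0; pose level n : R := n.+1%:R^-1 - 1.
pose good n T := [/\ totally_bounded_pairs T,
  forall t, T t -> A t.1 /\ A t.2 &
  forall t, T t -> rejects eps Z t.1 t.2 (level n)].
have /choice [f hf] : forall nT : nat * set (X * X), exists w, good nT.1 nT.2 ->
    [/\ Z w, w != 0 & good nT.1.+1 (adjoin M w nT.2)].
  move=> [n T]; have [[tbT AT rejT]|ng] := pselect (good n T); last by exists 0.
  have lt_level : level n.+1 < level n.
    by rewrite ltrD2r ltf_pV2 ?posrE ?ltr0Sn // ltr_nat.
  have [w [Zw w0 hw]] := rejects_shift_set lt_level tbT rejT.
  exists w => _; split=> //; split.
  - by apply: totally_bounded_adjoin => //; exact: ZA.
  - have Aaw a : A (a *: w) by apply: linear_subspaceZ => //; exact: ZA.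
    by move=> _ [t [a [Tt _ [|] ->]]]; have [A1 A2] := AT t Tt; split=> //=;
      exact: linear_subspaceD.
  - by move=> _ [t [a [Tt _ [|] ->]]]; have [] := hw t a Tt.
pose T := fix T n := if n is m.+1 then adjoin M (f (m, T m)) (T m) else [set (0, 0)].
pose w n := f (n, T n).
have TS n : T n.+1 = adjoin M (w n) (T n) by [].
have goodT n : good n (T n).
  elim: n => [|n IH]; last by rewrite TS; have [] := hf (n, T n) IH.
  have A0 : A 0 by case: sA.
  split=> [e e0|t ->//|t ->] /=; last by rewrite /level invr1 subrr.
  exists [:: (0, 0)]; split=> [p|t ->]; first by rewrite inE => /eqP ->.
  by exists (0, 0); rewrite ?mem_head //= subrr rnorm0 addr0.
exists w; split=> [n|n a I aM]; first by have [] := hf (n, T n) (goodT n).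
have memT : T n (\sum_(i < n | I i) a i *: w i, \sum_(i < n | ~~ I i) a i *: w i).
  elim: n aM => [|n IH] aM; first by rewrite !big_ord0.
  have Tn := IH (fun i ni => aM i (ltnW ni)).
  rewrite TS; eexists; exists (a n); split; [exact: Tn|exact: aM|].
  have recr (J : pred nat) : \sum_(i < n.+1 | J i) a i *: w i =
      \sum_(i < n | J i) a i *: w i + (if J n then a n *: w n else 0).
    by rewrite big_mkcond big_ord_recr /= -big_mkcond.
  rewrite recr (recr (predC I)) /=.
  by case: (I n) => /=; [left|right]; rewrite addr0.
have [_ _ /(_ _ memT) /= rejn] := goodT n.
apply: le_trans (rejects_gap cZ rejn).
by rewrite /level lerDr invr_ge0 ler0n.
Qed.

End Construction.

(** * From the gap inequality to bounded coordinate projections *)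

Section Suppression.
Set Implicit Arguments.
Unset Strict Implicit.
Variables (R : realType) (K : scalar_field R) (X : normedModType K).
Implicit Types (x y u v : X) (w : nat -> X) (a b : nat -> K) (I : pred nat) (e D : R).
Local Notation anorm := (@rnorm R K K).
Local Notation rnorm := (@rnorm R K X).

(** A finitary form of unconditionality: the coordinate projections onto all sets of indices are
    uniformly bounded. *)
Definition suppression_unconditional D w := forall n a I,
  rnorm (\sum_(i < n | I i) a i *: w i) <= D * rnorm (\sum_(i < n) a i *: w i).

Lemma sum_scaled n (c : K) a I w :
  \sum_(i < n | I i) (c * a i) *: w i = c *: \sum_(i < n | I i) a i *: w i.
Proof. by rewrite scaler_sumr; apply: eq_bigr => i _; rewrite scalerA. Qed.

Lemma sum_pred1 n k a w : (k < n)%N ->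
  \sum_(i < n | nat_of_ord i == k) a i *: w i = a k *: w k.
Proof. by move=> kn; rewrite (big_pred1 (Ordinal kn)). Qed.

(* A vector of norm at most 1 whose coefficients exceed the bound [3 / eps] can
   be shrunk until the largest of them equals the bound; for the shrunk vector
   the gap inequality gives the smaller bound [3 / (2 * eps)] instead. *)
Lemma suppression_of_gap (eps : R) w : 0 < eps -> eps <= 1 ->
  (forall n, w n != 0) ->
  (forall n a I, (forall i, (i < n)%N -> anorm (a i) * rnorm (w i) <= 3 / eps) ->
    - 1 <= gap eps (\sum_(i < n | I i) a i *: w i)
                   (\sum_(i < n | ~~ I i) a i *: w i)) ->
  suppression_unconditional (3 / (2 * eps)) w.
Proof.
move=> eps0 eps1 w0 hgap; set D := 3 / (2 * eps).
have D0 : 0 < D by rewrite divr_gt0 // mulr_gt0.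
have DM : D < 3 / eps.
  by rewrite /D invfM mulrA ltr_pM2r ?invr_gt0 //; lra.
have factA n a I : (forall i, (i < n)%N -> anorm (a i) * rnorm (w i) <= 3 / eps) ->
    rnorm (\sum_(i < n) a i *: w i) <= 1 ->
    rnorm (\sum_(i < n | I i) a i *: w i) <= D.
  (* Reversing the signs off [I] turns the gap inequality into [eps * rnorm (u - v) <= rnorm (u + v)
     + 1 <= 2]. As [u + u = (u + v) + (u - v)] and [eps <= 1], it follows that
     [2 * eps * rnorm u <= 3]. *)
  move=> aM S1; pose a' i := if I i then a i else - a i.
  have /(hgap n a' I) : forall i, (i < n)%N -> anorm (a' i) * rnorm (w i) <= 3 / eps.
    by move=> i /aM; rewrite /a'; case: (I i); rewrite ?rnormN.
  rewrite (bigID (fun i : 'I_n => I i)) /= in S1.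
  have -> : \sum_(i < n | I i) a' i *: w i = \sum_(i < n | I i) a i *: w i.
    by apply: eq_bigr => i Ii; rewrite /a' Ii.
  have -> : \sum_(i < n | ~~ I i) a' i *: w i = - \sum_(i < n | ~~ I i) a i *: w i.
    by rewrite -sumrN; apply: eq_bigr => i /negPf nIi; rewrite /a' nIi scaleNr.
  rewrite /gap opprK.
  set u := \sum_(i < n | I i) _ in S1 *; set v := \sum_(i < n | ~~ I i) _ in S1 *.
  move=> h; rewrite /D ler_pdivlMr ?mulr_gt0 //.
  have : rnorm (u + u) <= rnorm (u + v) + rnorm (u - v).
    have -> : u + u = (u + v) + (u - v) by rewrite addrACA subrr addr0.
    exact: rnormD.
  rewrite -mulr2n -scaler_nat rnormZ -(rmorph_nat (of_real R K)) rnorm_of_real //.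
  move=> /(ler_wpM2l (ltW eps0)).
  have := ler_wpM2r (rnorm_ge0 (u + v)) eps1; lra.
have factB n a : rnorm (\sum_(i < n) a i *: w i) <= 1 ->
    forall i, (i < n)%N -> anorm (a i) * rnorm (w i) <= 3 / eps.
  case: n => // n S1; pose F (i : 'I_n.+1) := anorm (a i) * rnorm (w i).
  have [k kmax] : exists k, forall i, F i <= F k.
    by case: (@arg_maxP _ _ _ ord0 predT F) => // k _ kmax; exists k => i; exact: kmax.
  suff Fk : F k <= 3 / eps.
    by move=> i ni; exact: le_trans (kmax (Ordinal ni)) Fk.
  rewrite leNgt; apply/negP => Fk.
  have M0 : 0 < 3 / eps := lt_trans D0 DM.
  have Fk0 : 0 < F k := lt_trans M0 Fk.
  pose t := 3 / eps / F k; have t0 : 0 <= t by rewrite divr_ge0 ?ltW.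
  have t1 : t <= 1 by rewrite ler_pdivrMr // mul1r ltW.
  pose c := of_real R K t; have ct : anorm c = t by rewrite rnorm_of_real.
  have := @factA n.+1 (fun i => c * a i) (fun i => i == k).
  rewrite (sum_pred1 (fun i => c * a i) _ (ltn_ord k)) rnormZ rnormM ct -mulrA.
  rewrite -/(F k) divfK ?gt_eqF // => h.
  have := DM; rewrite ltNge => /negP; apply; apply: h.
    move=> i ni; rewrite rnormM ct -mulrA -[leRHS](divfK (negbT (gt_eqF Fk0))).
    by rewrite ler_wpM2l //; exact: (kmax (Ordinal ni)).
  rewrite (sum_scaled _ _ _ xpredT) rnormZ ct.
  by rewrite -[leRHS]mulr1 ler_pM ?rnorm_ge0.
have factC n a I (r : R) : 0 < r -> rnorm (\sum_(i < n) a i *: w i) <= r ->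
    rnorm (\sum_(i < n | I i) a i *: w i) <= D * r.
  move=> r0 Sr; pose c := of_real R K r^-1.
  have ct : anorm c = r^-1 by rewrite rnorm_of_real // invr_ge0 ltW.
  have S1 : rnorm (\sum_(i < n) (c * a i) *: w i) <= 1.
    by rewrite (sum_scaled _ _ _ xpredT) rnormZ ct mulrC ler_pdivrMr // mul1r.
  have := factA n (fun i => c * a i) I (factB n (fun i => c * a i) S1) S1.
  by rewrite sum_scaled rnormZ ct mulrC ler_pdivrMr.
(* The full sum may vanish, so the scaling uses its norm increased by [e / D], with [e] arbitrarily
   small. *)
move=> n a I; apply/ler_addgt0Pr => e e0.
have eD : 0 < e / D by rewrite divr_gt0.
have := factC n a I (rnorm (\sum_(i < n) a i *: w i) + e / D).
rewrite mulrDr [D * (e / D)]mulrC divfK ?gt_eqF //; apply; last by rewrite lerDl ltW.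
by rewrite ltr_wpDl ?rnorm_ge0.
Qed.

End Suppression.

(** * Unconditional bases from bounded coordinate projections *)

Section UnconditionalBasis.
Set Implicit Arguments.
Unset Strict Implicit.
Variables (R : realType) (K : scalar_field R) (X : normedModType K).
Implicit Types (x y u v : X) (a b : nat -> K) (I : pred nat) (e : R).
Local Notation anorm := (@rnorm R K K).
Local Notation rnorm := (@rnorm R K X).

Lemma tends_partial_sum (a : nat -> nat -> K) b (w : nat -> X) m :
  (forall i, tends (fun k => a k i) (b i)) ->
  tends (fun k => \sum_(i < m) a k i *: w i) (\sum_(i < m) b i *: w i).
Proof.
move=> ab; elim: m => [|m IH] e e0.
  by exists 0%N => k _; rewrite !big_ord0 subrr rnorm0.
have e2 : 0 < e / 2 by rewrite divr_gt0.
have w0 : 0 < rnorm (w m) + 1 by rewrite ltr_wpDl ?rnorm_ge0.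
have [n1 h1] := IH _ e2; have [n2 h2] := ab m _ (divr_gt0 e2 w0).
exists (maxn n1 n2) => k; rewrite geq_max => /andP[/h1 k1 /h2 k2].
rewrite !big_ord_recr /= opprD addrACA -scalerBl.
apply: le_lt_trans (rnormD _ _) _; rewrite rnormZ.
move: k2; rewrite ltr_pdivlMr // mulrDr mulr1.
have := rnorm_ge0 (b m - a k m); lra.
Qed.

Variables (D : R) (w : nat -> X).
Hypotheses (D0 : 0 < D) (w0 : forall n, w n != 0).
Hypothesis suppress : suppression_unconditional D w.
Local Notation S n a := (\sum_(i < n) a i *: w i : X).

Let sumB n a b : \sum_(i < n) (a i - b i) *: w i = S n a - S n b.
Proof. by rewrite -sumrB; apply: eq_bigr => i _; rewrite scalerBl. Qed.

Lemma coefficient_bound n a i : (i < n)%N ->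
  anorm (a i) * rnorm (w i) <= D * rnorm (S n a).
Proof.
move=> ni; rewrite -rnormZ -(sum_pred1 _ _ ni).
exact: (suppress n a (fun j => j == i)).
Qed.

Lemma partial_sum_bound m n a : (m <= n)%N -> rnorm (S m a) <= D * rnorm (S n a).
Proof.
move=> mn; rewrite (big_ord_widen _ (fun i => a i *: w i) mn).
exact: (suppress n a (fun j => (j < m)%N)).
Qed.

(** A relation expressing [w n] by earlier vectors would be a vanishing sum whose coefficient at [n]
    is -1, against [coefficient_bound]. *)
Lemma free_suppression_unconditional : free_sequence w.
Proof.
move=> n /add_spanP [c] /= wn.
pose a i := if (i < n)%N then c i else - 1.
have := @coefficient_bound n.+1 a n (ltnSn n).
have -> : S n.+1 a = 0.
  rewrite big_ord_recr /= {2}/a ltnn scaleN1r; apply/eqP; rewrite subr_eq0 eq_sym.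
  move/eqP: wn; rewrite subr_eq0 => /eqP {1}->; apply/eqP.
  by apply: eq_bigr => i _; rewrite /a ltn_ord.
rewrite rnorm0 mulr0 /a ltnn rnormN rnorm1 mul1r => wn0.
by have := w0 n; rewrite -(rnorm_gt0 (K := K)) ltNge wn0.
Qed.

(** Finite combinations [a k] converging to [x] have Cauchy coefficients by [coefficient_bound]. The
    limits [b] are the coefficients of [x], because [partial_sum_bound] controls the partial sums of
    [a k - b] uniformly in their length. *)
Lemma expansion_exists x : closed_span w x -> exists a, tends (fun n => S n a) x.
Proof.
move=> hx; have [r r0 small] := exists_null_sequence R.
have /choice [a ha] : forall k : nat, exists a, exists N, forall m, (N <= m)%N ->
    rnorm (x - S m a) < r k.
  move=> k; have [n [y /add_spanP [c /= /eqP]]] := hx _ (r0 k).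
  rewrite subr_eq0 => /eqP -> xy.
  (* Extended by zero, a finite combination equals all its partial sums from [n] on. *)
  exists (fun i => if (i < n)%N then c i else 0), n => m nm.
  suff -> : \sum_(i < m) (if (i < n)%N then c i else 0) *: w i = S n c by [].
  rewrite (big_ord_widen _ (fun i => c i *: w i) nm) [RHS]big_mkcond.
  by apply: eq_bigr => i _; case: ifP => // _; rewrite scale0r.
have close k l m : exists2 M, (m <= M)%N &
    rnorm (\sum_(i < M) (a k i - a l i) *: w i) < r k + r l.
  have [Nk hk] := ha k; have [Nl hl] := ha l.
  exists (maxn m (maxn Nk Nl)); first exact: leq_maxl.
  set M := maxn m _.
  have := hk M (leq_trans (leq_maxl _ _) (leq_maxr _ _)).
  have := hl M (leq_trans (leq_maxr _ _) (leq_maxr _ _)).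
  have := rnorm_triangle (S M (a k)) x (S M (a l)).
  rewrite sumB (rnormBC _ x); lra.
have closeS k l m : rnorm (S m (a k) - S m (a l)) <= D * (r k + r l).
  have [M mM /ltW lt] := close k l m; rewrite -sumB.
  apply: le_trans (partial_sum_bound (fun i => a k i - a l i) mM) _.
  by rewrite ler_pM2l.
have /choice [b hb] : forall i, exists l, tends (fun k => a k i) l.
  move=> i; apply: scalar_cauchy => e e0.
  have wi0 : 0 < rnorm (w i) by rewrite rnorm_gt0.
  have [n hn] := small (e * rnorm (w i) / (2 * D))
    (divr_gt0 (mulr_gt0 e0 wi0) (mulr_gt0 (ltr0Sn _ 1) D0)).
  exists n => m nm; rewrite -(ltr_pM2r wi0).
  have [M iM lt] := close m n i.+1.
  apply: le_lt_trans (@coefficient_bound _ (fun i => a m i - a n i) _ iM) _.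
  have := hn m nm; have := hn n (leqnn n).
  rewrite !ltr_pdivlMr ?mulr_gt0 //.
  have := ler_wpM2l (ltW D0) (ltW lt); lra.
(* The bound is independent of [m]; it comes from [closeS] by taking [l] large, with [r l < r k]. *)
have limit k m : rnorm (S m (a k) - S m b) <= D * (2 * r k).
  apply/ler_addgt0Pr => e e0.
  have [n hn] := tends_partial_sum w m hb e0.
  have [n' hn'] := small _ (r0 k); pose l := maxn n' n.
  have lk := ltW (hn' l (leq_maxl _ _)).
  have := hn l (leq_maxr _ _); rewrite (rnormBC (S m b)).
  have := rnorm_triangle (S m (a k)) (S m (a l)) (S m b).
  have := closeS k l m; have := ler_wpM2l (ltW D0) lk; lra.
exists b => e e0.
have cst : 0 < 1 + 2 * D by rewrite ltr_wpDr // mulr_ge0 // ltW.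
have [k /(_ k (leqnn k)) hk] := small _ (divr_gt0 e0 cst).
have [N hN] := ha k; exists N => m Nm.
have := rnorm_triangle x (S m (a k)) (S m b).
have := hN m Nm; have := limit k m.
move: hk; rewrite ltr_pdivlMr //; lra.
Qed.

(** The partial sums of the difference tend to 0, and by [coefficient_bound] they dominate each of
    its coefficients. *)
Lemma expansion_unique x a b :
  tends (fun n => S n a) x -> tends (fun n => S n b) x -> a = b.
Proof.
move=> ax bx; apply/funext => i; apply/eqP; rewrite -subr_eq0; apply/eqP.
apply: (@rnorm_small _ K) => e e0.
have wi0 : 0 < rnorm (w i) by rewrite rnorm_gt0.
have e2 : 0 < e * rnorm (w i) / (2 * D) by rewrite divr_gt0 ?mulr_gt0.
have [n1 h1] := ax _ e2; have [n2 h2] := bx _ e2.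
pose n := maxn i.+1 (maxn n1 n2).
rewrite -(ler_pM2r wi0).
apply: le_trans (@coefficient_bound n (fun i => a i - b i) i (leq_maxl _ _)) _.
rewrite sumB.
have := h1 n (leq_trans (leq_maxl _ _) (leq_maxr _ _)).
have := h2 n (leq_trans (leq_maxr _ _) (leq_maxr _ _)).
have := ler_wpM2l (ltW D0) (rnorm_triangle (S n a) x (S n b)).
rewrite (rnormBC _ x) !ltr_pdivlMr ?mulr_gt0 //; lra.
Qed.

(** A late block of the rearranged series is the part of an ordinary tail of the original series
    over some set of indices; suppression bounds it by [D] times the norm of that tail. *)
Lemma rearrangement_cauchy a x (s : nat -> nat) : bijective s ->
  tends (fun n => S n a) x ->
  cauchy_sequence (fun n => \sum_(i < n) a (s i) *: w (s i) : X).
Proof.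
move=> [g sK gK] /tends_cauchy ca e e0.
have [n hn] := ca _ (divr_gt0 e0 D0).
(* [M] exceeds the preimages of all indices below [n], so these are no longer visited from [M]
   on. *)
pose M := \max_(j < n) (g j).+1.
have sM i : (M <= i)%N -> (n <= s i)%N.
  move=> Mi; rewrite leqNgt; apply/negP => sn.
  have := leq_trans (@leq_bigmax _ (fun j : 'I_n => (g j).+1) (Ordinal sn)) Mi.
  by rewrite /= sK ltnn.
exists M => m Mm.
rewrite -!(big_mkord xpredT (fun i => a (s i) *: w (s i))) (big_cat_nat _ Mm) //=.
rewrite addrAC subrr add0r.
pose r := [seq s i | i <- index_iota M m].
pose I : pred nat := fun j => j \in r.
pose L := maxn n (\max_(j < m) (s j).+1).
have mem_r (j : nat) : j \in r -> (n <= j)%N /\ (j < L)%N.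
  move=> /mapP[i + ->]; rewrite mem_index_iota => /andP[Mi im]; split; first exact: sM.
  by rewrite leq_max (@leq_bigmax _ (fun j : 'I_m => (s j).+1) (Ordinal im)) orbT.
have -> : \sum_(M <= i < m) a (s i) *: w (s i) = \sum_(j < L | I j) a j *: w j.
  rewrite -(big_map s xpredT (fun j => a j *: w j)) -/r.
  rewrite -(big_mkord I (fun j => a j *: w j)) -[RHS]big_filter.
  apply: perm_big; apply: uniq_perm.
  - by rewrite map_inj_uniq ?iota_uniq //; exact: can_inj sK.
  - by rewrite filter_uniq ?iota_uniq.
  move=> j; rewrite mem_filter mem_index_iota /= /I andbC.
  by case: (boolP (j \in r)) => [/mem_r[_ ->]|]; rewrite ?andbF.
(* The block meets no index below [n], so the coefficients there may be set to 0; the full sum then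
   becomes the tail [S L a - S n a], small by the Cauchy property. *)
pose a' j := if (j < n)%N then 0 else a j.
have -> : \sum_(j < L | I j) a j *: w j = \sum_(j < L | I j) a' j *: w j.
  by apply: eq_bigr => j /mem_r[+ _]; rewrite /a' leqNgt => /negPf ->.
apply: le_lt_trans (suppress L a' I) _; rewrite mulrC -ltr_pdivlMr //.
suff -> : S L a' = S L a - S n a by apply: hn; exact: leq_maxl.
have nL : (n <= L)%N by exact: leq_maxl.
rewrite (big_ord_widen _ (fun i => a i *: w i) nL) [X in _ - X]big_mkcond -sumrB.
apply: eq_bigr => j _; rewrite /a'; case: ifP => _; first by rewrite scale0r subrr.
by rewrite subr0.
Qed.

Lemma unconditional_basis_closed_span :
  (forall u : nat -> X, cauchy_sequence u -> exists l, tends u l) ->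
  unconditional_basis (closed_span w) w.
Proof.
move=> completeX.
have seriesE (u : nat -> X) : series u = (fun n => \sum_(i < n) u i).
  by apply/funext => n; rewrite seriesEord.
split; first split.
- exact: mem_closed_span.
- move=> x /expansion_exists [a ax]; exists a; split.
    by rewrite seriesE; apply/tendsP.
  move=> b; rewrite seriesE => /tendsP bx; exact: expansion_unique ax bx.
- move=> a; rewrite seriesE => /cvg_ex [x /tendsP ax] s bs.
  rewrite seriesE; have [l /tendsP hl] := completeX _ (rearrangement_cauchy bs ax).
  by apply/cvg_ex; exists l.
Qed.

End UnconditionalBasis.

(** * The dichotomy over either scalar field *)

Theorem gowers_dichotomy (R : realType) (K : scalar_field R)
    (X : completeNormedModType K) : ~ finite_dimensional [set: X] ->
  exists W : set X, closed_inf_subspace W /\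
    ((exists e : nat -> X, unconditional_basis W e) \/
     hereditarily_indecomposable W).
Proof.
move=> infX.
have cX : closed_inf_subspace [set: X] by apply/closed_inf_subspaceP.
have [acc|] := pselect (forall n (Y : set X), closed_inf_subspace Y ->
    exists Z, [/\ closed_inf_subspace Z, Z `<=` Y & accepts (n.+1%:R^-1 : R) Z 0 0 0]).
  (* A diagonal subspace serves all [n] at once: any two subspaces of it can be cut down to the one
     that accepts for [n]. *)
  have [|z [fz _ hz]] := diagonal_subspace
    (P := fun n Z => accepts (n.+1%:R^-1 : R) Z 0 0 0) cX.
    by move=> n U cU _; exact: acc.
  exists (closed_span z); split; first exact: closed_inf_span.
  right; apply: hereditarily_indecomposable_accepts => n U V cU cV UW VW.
  have [Z [accZ capZ]] := hz n.
  have [||u [v [[Uu _] [Vv _] lt0]]] := accZ _ _ (capZ _ cU UW) (capZ _ cV VW).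
  - by move=> x [].
  - by move=> x [].
  - by exists u, v; split.
move=> /existsNP[n /existsNP[Y /not_implyP[cY nacc]]].
pose eps : R := n.+1%:R^-1.
have eps0 : 0 < eps by rewrite invr_gt0 ltr0Sn.
have eps1 : eps <= 1 by rewrite invf_le1 ?ltr0Sn // ler1n.
(* With a trivial property the diagonal lemma provides just a free sequence in [Y]; its closed span
   is separable, as [deciding_subspace] requires. *)
have [|z [fz zY _]] := diagonal_subspace (P := fun _ _ => True) cY.
  by move=> _ U cU _; exists U; split.
have [Z [cZ Zz decides]] := deciding_subspace (ltW eps0) eps1 fz.
have rej : rejects eps Z 0 0 0.
  move=> Z' cZ' Z'Z acc; apply: nacc; exists Z'; split=> //.
  exact: subset_trans Z'Z (subset_trans Zz zY).
(* [3 / eps] is the coefficient bound under which [suppression_of_gap] asks for the gap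
   inequality. *)
have [w [hw gapw]] := rejecting_sequence eps0 eps1
  (linear_subspace_closed_span z) cZ Zz decides (3 / eps) rej.
have w0 k : w k != 0 by have [] := hw k.
have supp := suppression_of_gap eps0 eps1 w0 gapw.
have D0 : 0 < 3 / (2 * eps) by rewrite divr_gt0 // mulr_gt0.
exists (closed_span w); split.
  by apply: closed_inf_span; exact: free_suppression_unconditional supp.
left; exists w; apply: unconditional_basis_closed_span supp _ => //.
exact: cauchy_tends.
Qed.

(** * The real and the complex numbers as scalars *)

Lemma real_disc_net (R : realType) (M e : R) : 0 < e -> exists s : seq R,
  forall a, `|a| <= M -> exists2 b, b \in s & `|a - b| < e.
Proof.
(* A grid of step [e] starting at [- M]; truncation finds the grid point just below [a]. *)
move=> e0; exists [seq i%:R * e - M | i <- iota 0 (Num.truncn (2 * M / e)).+1].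
move=> a; rewrite ler_norml => /andP[Ma aM].
have x0 : 0 <= (a + M) / e by rewrite divr_ge0 ?(ltW e0) //; lra.
have /andP[lb ub] := truncn_itv x0.
exists ((Num.truncn ((a + M) / e))%:R * e - M).
  apply/mapP; exists (Num.truncn ((a + M) / e)) => //.
  by rewrite mem_iota /= add0n ltnS le_truncn // ler_pM2r ?invr_gt0 //; lra.
set k := Num.truncn _ in lb ub *; move: lb ub.
rewrite ler_pdivlMr // ltr_pdivrMr // -natr1 mulrDl mul1r.
by move=> lb ub; rewrite ltr_norml; apply/andP; split; lra.
Qed.

Lemma real_complete (R : realType) (a : nat -> R) :
  (forall e, 0 < e -> exists n, forall m, (n <= m)%N -> `|a m - a n| < e) ->
  exists l, forall e, 0 < e -> exists n, forall m, (n <= m)%N -> `|l - a m| < e.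
Proof.
move=> ca; have /cvg_ex [l al] : cvgn a.
  apply/cauchy_cvgP; apply: cauchy_exP => e e0; have [n hn] := ca e e0.
  by exists (a n); exists n => // m /= nm; rewrite -ball_normE /= distrC hn.
exists l => e e0; have /cvgrPdist_lt/(_ _ e0)[n _ hn] := al.
by exists n => m nm; exact: hn.
Qed.

Definition real_scalars (R : realType) : scalar_field R :=
  @ScalarField R R idfun (fun _ _ => erefl) (fun k _ => ex_intro _ k erefl)
    (@real_complete R) (@real_disc_net R).

Section ComplexScalars.
Local Open Scope complex_scope.
Variable R : realType.
Implicit Type z : R[i].

Lemma norm_complex_ub z : `|z| <= (`|complex.Re z| + `|complex.Im z|)%:C.
Proof.
case: z => x y /=.
rewrite normc_def lecR /= -[leRHS]ger0_norm ?addr_ge0 // -sqrtr_sqr ler_wsqrtr //.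
by rewrite sqrrD !real_normK ?num_real // addrAC lerDl mulrn_wge0 // mulr_ge0.
Qed.

Lemma norm_complex_Re z : `|complex.Re z|%:C <= `|z|.
Proof. exact: normc_ge_Re. Qed.

Lemma norm_complex_Im z : `|complex.Im z|%:C <= `|z|.
Proof.
case: z => x y; rewrite normc_def /= lecR -sqrtr_sqr ler_wsqrtr //.
by rewrite lerDr sqr_ge0.
Qed.

Lemma complex_complete (a : nat -> R[i]) :
  (forall e : R, 0 < e -> exists n, forall m, (n <= m)%N -> `|a m - a n| < e%:C) ->
  exists l, forall e : R, 0 < e ->
    exists n, forall m, (n <= m)%N -> `|l - a m| < e%:C.
Proof.
move=> ca.
have [|x hx] := @real_complete R (fun n => complex.Re (a n)).
  move=> e /ca [n hn]; exists n => m /hn; rewrite -raddfB /= -ltcR.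
  exact: le_lt_trans (norm_complex_Re _).
have [|y hy] := @real_complete R (fun n => complex.Im (a n)).
  move=> e /ca [n hn]; exists n => m /hn; rewrite -raddfB /= -ltcR.
  exact: le_lt_trans (norm_complex_Im _).
exists (x +i* y) => e e0; have e2 : 0 < e / 2 by rewrite divr_gt0.
have [n1 h1] := hx _ e2; have [n2 h2] := hy _ e2; exists (maxn n1 n2) => m.
rewrite geq_max => /andP[/h1 {}h1 /h2 {}h2].
apply: le_lt_trans (norm_complex_ub _) _; rewrite ltcR !raddfB /=; lra.
Qed.

Lemma complex_disc_net (M e : R) : 0 < e -> exists s : seq R[i],
  forall z, `|z| <= M%:C -> exists2 b, b \in s & `|z - b| < e%:C.
Proof.
move=> e0; have e2 : 0 < e / 2 by rewrite divr_gt0.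
have [s hs] := real_disc_net M e2.
exists [seq x +i* y | x <- s, y <- s] => z zM.
have [|x xs zx] := hs (complex.Re z).
  by rewrite -lecR; apply: le_trans zM; exact: norm_complex_Re.
have [|y ys zy] := hs (complex.Im z).
  by rewrite -lecR; apply: le_trans zM; exact: norm_complex_Im.
exists (x +i* y); first by apply/allpairsP; exists (x, y).
apply: le_lt_trans (norm_complex_ub _) _; rewrite ltcR !raddfB /=; lra.
Qed.

Lemma nonneg_complex_real z : 0 <= z -> exists r : R, r%:C = z.
Proof.
case: z => x y; rewrite lecE /= => /andP[/eqP -> _]; exists x.
by apply/eqP; rewrite eq_complex /= !eqxx.
Qed.

Definition complex_scalars : scalar_field R :=
  @ScalarField R R[i] (real_complex R) (@lecR R) nonneg_complex_real
    complex_complete complex_disc_net.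

End ComplexScalars.

Theorem theorem1p4 (R : realType) :
  (forall X : completeNormedModType R,
     ~ finite_dimensional [set: X] ->
     exists W : set X,
       closed_inf_subspace W /\
       ((exists e : nat -> X, unconditional_basis W e) \/
        hereditarily_indecomposable W)) /\
  (forall X : completeNormedModType R[i],
     ~ finite_dimensional [set: X] ->
     exists W : set X,
       closed_inf_subspace W /\
       ((exists e : nat -> X, unconditional_basis W e) \/
        hereditarily_indecomposable W)).
Proof.
split=> X.
  exact: (@gowers_dichotomy R (real_scalars R) X).
exact: (@gowers_dichotomy R (complex_scalars R) X).
Qed.
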